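(* Let $1\le n<\omega$ and let $\kappa$ be a cardinal. The following are equivalent. (1) $\kappa\ge\omega_n$. (2) For each family $\mathcal{D}\subseteq[\kappa]^{<\aleph_1}$ that is directed under inclusion and has union $\kappa$, there exist $A_0,\dots,A_{n-1}\in\mathcal{D}$ such that $\bigcap_{j\ne i}A_j\not\subseteq A_i$ for all $i<n$. (3) For each club $\mathcal{E}\subseteq[\kappa]^{<\aleph_1}$, there exist $B_0,\dots,B_{n-1}\in\mathcal{E}$ such that $\bigcap_{j\ne i}B_j\not\subseteq B_i$ for all $i<n$. (4) For each $x\in H(\theta)$, there exist countable $M_0,\dots,M_{n-1}\prec\mathfrak{H}$ such that $x\in M_i$ and $\kappa\cap\bigcap_{j\ne i}M_j\not\subseteq M_i$ for all $i<n$. (5) For each $x\in H(\theta)$, there exist $M_0,\dots,M_{n-1}\prec\mathfrak{H}$ such that $x\in M_i$ and $\kappa\cap\bigcap_{j\ne i}M_j\not\subseteq M_i$ for all $i<n$.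
   Context: $[\kappa]^{<\aleph_1}$ is the set of countable subsets of $\kappa$; a club in it is a family cofinal under inclusion and closed under unions of countable nonempty chains. $\theta$ is a regular uncountable cardinal, assumed large enough (in particular $\kappa\in H(\theta)$ and all sets relevant to the statement lie in $H(\theta)$); $H(\theta)$ is the set of sets with transitive closure of size $<\theta$; $\mathfrak{H}=(H(\theta),\in,\sqsubset_\theta)$ where $\sqsubset_\theta$ is a fixed well-ordering of $H(\theta)$; $M\prec\mathfrak{H}$ means $M$ is the universe of an elementary substructure of $\mathfrak{H}$. *)

(* Defs.v *)
From mathcomp Require Import all_boot.
From mathcomp Require Import all_classical.
From Stdlib Require Import Relation_Operators.

Set Implicit Arguments.
Unset Strict Implicit.
Unset Printing Implicit Defensive.

Local Open Scope classical_set_scope.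
Local Open Scope card_scope.

(** The set-theoretic universe: Aczel's well-founded trees modulo bisimilarity.
    With the classical axioms of [boolp] this is a model of ZFC. *)

Inductive tree : Type := Tree (A : Type) (f : A -> tree).

Fixpoint tree_eq (s t : tree) : Prop :=
  match s, t with
  | Tree A f, Tree B g =>
      (forall i, exists j, tree_eq (f i) (g j)) /\
      (forall j, exists i, tree_eq (f i) (g j))
  end.

Definition tree_mem (s t : tree) : Prop :=
  match t with Tree B g => exists j, tree_eq s (g j) end.

(** A [ZFset] is a [tree_eq]-class of trees, so that Leibniz equality on
    [ZFset] is extensional equality of sets (see [elts_inj]). *)
Definition ZFset : Type := {C : tree -> Prop | exists t, C = tree_eq t}.

Definition ZFmem (x y : ZFset) : Prop :=
  exists s t, [/\ sval x s, sval y t & tree_mem s t].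

Notation "x ∈ y" := (ZFmem x y) (at level 70, no associativity).

Definition elts (x : ZFset) : set ZFset := [set y | y ∈ x].

Lemma tree_eq_refl t : tree_eq t t.
Proof. by elim: t => A f IH /=; split=> i; exists i. Qed.

Lemma tree_eq_sym s t : tree_eq s t -> tree_eq t s.
Proof.
elim: s t => A f IH [B g] /= [fg gf]; split.
- by move=> j; have [i /IH] := gf j; exists i.
- by move=> i; have [j /IH] := fg i; exists j.
Qed.

Lemma tree_eq_trans s t u : tree_eq s t -> tree_eq t u -> tree_eq s u.
Proof.
elim: s t u => A f IH [B g] [C h] /= [fg gf] [gh hg]; split.
- move=> i; have [j fgj] := fg i; have [k ghk] := gh j.
  by exists k; apply: IH fgj ghk.
- move=> k; have [j ghk] := hg k; have [i fgj] := gf j.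
  by exists i; apply: IH fgj ghk.
Qed.

Lemma tree_eqE s t : tree_eq s t -> tree_eq s = tree_eq t.
Proof.
move=> st; apply/funext => u; apply/propext; split.
- exact/tree_eq_trans/tree_eq_sym.
- exact: tree_eq_trans.
Qed.

Definition set_of_tree (t : tree) : ZFset :=
  exist _ (tree_eq t) (ex_intro _ t erefl).

Lemma set_of_tree_surj x : exists t, x = set_of_tree t.
Proof.
case: x => C CP; have [t Ct] := CP; exists t; rewrite /set_of_tree.
by subst C; congr exist; exact: Prop_irrelevance.
Qed.

Lemma set_of_tree_eq s t : tree_eq s t -> set_of_tree s = set_of_tree t.
Proof. by move=> /tree_eqE st; apply: eq_exist. Qed.

Lemma elts_tree A (f : A -> tree) :
  elts (set_of_tree (Tree f)) = range (fun i => set_of_tree (f i)).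
Proof.
apply/seteqP; split=> [x [s [[B g] [/= xs [fg gf] [j sgj]]]]|_ [i _ <-]] /=.
- have [i fij] := gf j; exists i => //.
  have [t xE] := set_of_tree_surj x; move: xs; rewrite xE /= => ts.
  apply: set_of_tree_eq; apply: tree_eq_trans fij _; apply: tree_eq_sym.
  exact: tree_eq_trans ts sgj.
- exists (f i), (Tree f); split; [exact: tree_eq_refl | exact: tree_eq_refl |].
  by exists i; exact: tree_eq_refl.
Qed.

(** Extensionality. *)
Lemma elts_inj : injective elts.
Proof.
move=> x y; have [[A f] ->] := set_of_tree_surj x.
have [[B g] ->] := set_of_tree_surj y; rewrite !elts_tree => E.
have eqT s t : set_of_tree s = set_of_tree t -> tree_eq s t.
  by move=> /(congr1 sval) /= ->; exact: tree_eq_refl.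
apply: set_of_tree_eq; split=> [i|j].
- have : range (fun j => set_of_tree (g j)) (set_of_tree (f i)).
    by rewrite -E; exists i.
  by move=> [j _ /esym/eqT]; exists j.
- have : range (fun i => set_of_tree (f i)) (set_of_tree (g j)).
    by rewrite E; exists j.
  by move=> [i _ /eqT]; exists i.
Qed.

(** Foundation. *)
Lemma ZFmem_wf : well_founded ZFmem.
Proof.
move=> x; have [t ->] := set_of_tree_surj x.
elim: t => A f IH; constructor=> y yf.
have : elts (set_of_tree (Tree f)) y by [].
by rewrite elts_tree => -[i _ <-]; apply: IH.
Qed.

Definition index (t : tree) : Type := let: Tree A _ := t in A.

(** Every set is the range of a family over the index type of a tree, and
    conversely; pairs, unions, power sets, replacement follow. *)
Lemma elts_small x :
  exists t (f : index t -> ZFset), elts x = range f.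
Proof.
have [[A f] ->] := set_of_tree_surj x; exists (Tree f).
by exists (fun i => set_of_tree (f i)); exact: elts_tree.
Qed.

Lemma small_elts t (f : index t -> ZFset) : exists x, elts x = range f.
Proof.
have [g gE] := choice (fun i => set_of_tree_surj (f i)).
have -> : f = (fun i => set_of_tree (g i)) by apply: funext.
by exists (set_of_tree (Tree g)); exact: elts_tree.
Qed.

(** Strict well-orderings of a class. *)
Definition well_orders (A : set ZFset) (R : ZFset -> ZFset -> Prop) : Prop :=
  [/\ forall x, A x -> ~ R x x,
      forall x y z, A x -> A y -> A z -> R x y -> R y z -> R x z,
      forall x y, A x -> A y -> [\/ R x y, x = y | R y x] &
      forall B, B `<=` A -> B !=set0 ->
        exists2 x, B x & forall y, B y -> x = y \/ R x y].

(** Von Neumann ordinals; cardinals are the initial ordinals. *)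
Definition transitive_set (x : ZFset) : Prop :=
  forall y, y ∈ x -> elts y `<=` elts x.

Definition is_ordinal (a : ZFset) : Prop :=
  transitive_set a /\ well_orders (elts a) ZFmem.

(** The order of the ordinals: [a <= b] iff [a] is a subset of [b]. *)
Definition ord_le (a b : ZFset) : Prop := elts a `<=` elts b.

Definition is_cardinal (k : ZFset) : Prop :=
  is_ordinal k /\ forall a, a ∈ k -> elts a #!= elts k.

Definition is_least (P : set ZFset) (x : ZFset) : Prop :=
  P x /\ forall y, P y -> ord_le x y.

(** [is_omega n w]: [w] is the cardinal omega_n. *)
Fixpoint is_omega (n : nat) : set ZFset :=
  match n with
  | 0 => is_least [set k | is_cardinal k /\ infinite_set (elts k)]
  | m.+1 => is_least [set k | is_cardinal k /\ exists2 l, is_omega m l & l ∈ k]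
  end.

(** A cardinal is regular when it is infinite and all its unbounded subsets
    have full cardinality. *)
Definition is_regular (k : ZFset) : Prop :=
  [/\ is_cardinal k, infinite_set (elts k) &
      forall X, elts X `<=` elts k ->
        (forall a, a ∈ k -> exists2 b, b ∈ X & ord_le a b) ->
        elts X #= elts k].

(** Transitive closure: [x], the elements of [x], their elements, and so on
    are reached by chains of memberships. *)
Definition trcl (x : ZFset) : set ZFset := [set y | clos_trans _ ZFmem y x].

Definition card_lt T U (A : set T) (B : set U) : Prop :=
  (A #<= B) /\ ~ (B #<= A).

Definition H (theta : ZFset) : set ZFset :=
  [set x | card_lt (trcl x) (elts theta)].

(** First-order logic in the language of (H(theta), in, lt); variables are
    natural numbers, and quantifiers range over the universe [M]. *)
Inductive formula : Type :=
| fEq of nat & nat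
| fMem of nat & nat
| fLt of nat & nat
| fNot of formula
| fAnd of formula & formula
| fEx of nat & formula.

Definition update (v : nat -> ZFset) (i : nat) (a : ZFset) : nat -> ZFset :=
  fun j => if j == i then a else v j.

Fixpoint sat (M : set ZFset) (lt : ZFset -> ZFset -> Prop)
    (v : nat -> ZFset) (phi : formula) : Prop :=
  match phi with
  | fEq i j => v i = v j
  | fMem i j => v i ∈ v j
  | fLt i j => lt (v i) (v j)
  | fNot p => ~ sat M lt v p
  | fAnd p q => sat M lt v p /\ sat M lt v q
  | fEx i p => exists2 a, M a & sat M lt (update v i a) p
  end.

(** [M] is the universe of an elementary substructure of (N, in, lt). *)
Definition elementary (M N : set ZFset) (lt : ZFset -> ZFset -> Prop) : Prop :=
  [/\ M !=set0, M `<=` N &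
      forall phi v, (forall i, M (v i)) -> (sat M lt v phi <-> sat N lt v phi)].

(** [ctbl_subsets k] is [k]^{<aleph_1}. *)
Definition ctbl_subsets (k : ZFset) : set ZFset :=
  [set A | elts A `<=` elts k /\ countable (elts A)].

Definition directed (D : ZFset) : Prop :=
  elts D !=set0 /\
  forall A B, A ∈ D -> B ∈ D ->
    exists C, [/\ C ∈ D, elts A `<=` elts C & elts B `<=` elts C].

Definition union_of (D U : ZFset) : Prop :=
  elts U = \bigcup_(A in elts D) elts A.

Definition is_chain (C : ZFset) : Prop :=
  forall A B, A ∈ C -> B ∈ C -> elts A `<=` elts B \/ elts B `<=` elts A.

(** [E] is a club in [k]^{<aleph_1}. *)
Definition is_club (k E : ZFset) : Prop :=
  [/\ elts E `<=` ctbl_subsets k,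
      forall A, ctbl_subsets k A -> exists2 B, B ∈ E & elts A `<=` elts B &
      forall C U, elts C `<=` elts E -> countable (elts C) ->
        elts C !=set0 -> is_chain C -> union_of C U -> U ∈ E].

(** For all [i], the intersection of [k] and the [A j], [j != i], is not
    included in [A i].  Intersecting with [k] changes nothing for two or more
    subsets of [k]; for a single one it makes the empty intersection [k]. *)
Definition none_covers n (k : ZFset) (A : 'I_n -> ZFset) : Prop :=
  forall i, ~ (elts k `&` \bigcap_(j in [set~ i]) elts (A j) `<=` elts (A i)).

(** H(theta) contains k, omega_n and all families of countable subsets of k. *)
Definition large_enough (n : nat) (k theta : ZFset) : Prop :=
  [/\ H theta k,
      forall w, is_omega n w -> H theta w &
      forall D, elts D `<=` ctbl_subsets k -> H theta D].

(* Main.v *)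
Require Import Defs.
From HB Require Import structures.
From mathcomp Require Import all_boot.
From mathcomp Require Import all_classical.
From Stdlib Require Import Relation_Operators Wellfounded.

(** (1) => (2): by Kuratowski's free set theorem a set-valued map [F] with
    countable values on the finite sequences of [kappa >= omega_n] has a free
    set [{t_i}] of size [n]; if [F s] is a member of the directed family that
    includes [s], then [t_i] witnesses that [A_i = F (t_j)_(j <> i)] does not
    cover the intersection of the other ones.
    (3) => (4): the countable [A] that equal the trace on [kappa] of the Skolem
    hull of [A] and [x] form a club.
    (5) => (1): let [x] encode injections [f b] of each [b < kappa] into its
    cardinal, and suppose that [t_i] belongs to every [M_j] but [M_i].  If [t_k]
    is the largest of the [t_i], the [f t_k t_i], [i <> k], have the same
    property with respect to the [M_i], [i <> k], and live in the smaller
    cardinal [|t_k|].  For [kappa < omega_n], after [n - 1] steps a finite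
    ordinal is left out of an elementary substructure, which is absurd. *)

Set Implicit Arguments.
Unset Strict Implicit.
Unset Printing Implicit Defensive.

Local Open Scope classical_set_scope.
Local Open Scope card_scope.

(** * Existence of sets: separation, power sets, countable classes *)

Definition ZFempty : ZFset :=
  set_of_tree (Tree (fun e : False => False_rect tree e)).

HB.instance Definition _ := gen_eqMixin ZFset.
HB.instance Definition _ := gen_choiceMixin ZFset.
HB.instance Definition _ := isPointed.Build ZFset ZFempty.

Lemma card_le_injP T (U : pointedType) (A : set T) (B : set U) :
  A #<= B <-> exists2 f : T -> U, set_fun A B f & set_inj A f.
Proof. by split=> [/pcard_leP/injfunPex|/injfunPex/pcard_leP]. Qed.

Lemma card_le_sub_image T U (A : set U) (B : set T) (f : T -> U) :
  A `<=` f @` B -> A #<= B.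
Proof.
by move=> AfB; apply: card_le_trans (subset_card_le AfB) (card_image_le _ _).
Qed.

Lemma separation (A : ZFset) (P : set ZFset) :
  exists x, elts x = elts A `&` P.
Proof.
have [t [f ->]] := elts_small A.
(* Only the index type of this tree matters, the subtype of the indices whose value satisfies [P];
   the branches [t] are arbitrary. *)
have [x xE] := @small_elts (Tree (fun _ : {i : Defs.index t | P (f i)} => t))
  (fun i => f (sval i)).
exists x; rewrite xE; apply/seteqP; split=> [_ [i _ <-]|_ [[i _ <-] Pi]].
  by split; [exists (sval i) | case: i].
by exists (exist _ i Pi).
Qed.

Lemma separation_sub (A : ZFset) (P : set ZFset) :
  P `<=` elts A -> exists x, elts x = P.
Proof.
by move=> PA; have [x xE] := separation A P; exists x; rewrite xE setIC setIidl.
Qed.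

Lemma powerset (A : ZFset) : exists p, elts p = [set z | elts z `<=` elts A].
Proof.
have [t [f AE]] := elts_small A.
have sub (S : Defs.index t -> Prop) : exists x, elts x = f @` S.
  by apply: (@separation_sub A); rewrite AE => _ [i _ <-]; exists i.
have [g gE] := choice sub.
(* A subset of [A] is named by a predicate on the indices of [A]. *)
have [p pE] := @small_elts (Tree (fun _ : Defs.index t -> Prop => t)) g.
exists p; rewrite pE; apply/seteqP; split=> [_ [S _ <-] /=|z /= zA].
  by rewrite gE AE => _ [i _ <-]; exists i.
exists (fun i => f i ∈ z) => //; apply: elts_inj; rewrite gE.
apply/seteqP; split=> [_ [i iz <-] //|y yz].
by have := zA y yz; rewrite AE => -[i _ fiy]; exists i; rewrite // fiy.
Qed.

Lemma family_of_subsets (A : ZFset) (P : set ZFset) :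
  (forall z, P z -> elts z `<=` elts A) -> exists x, elts x = P.
Proof.
by have [p pE] := powerset A => PA; apply: (@separation_sub p); rewrite pE.
Qed.

Lemma countable_ZFset (A : set ZFset) : countable A -> exists x, elts x = A.
Proof.
move=> /countable_injP [f f_inj].
(* The codes in [nat] serve as indices, since [ZFset] lives in too large a universe to index a tree.
   The default [point] is never reached. *)
have [x xE] := @small_elts (Tree (fun _ : {n : nat | (f @` A) n} =>
    Tree (False_rect tree)))
  (fun n => xget point [set a | A a /\ f a = sval n]).
exists x; rewrite xE; apply/seteqP; split=> [_ [[n An] _ <-]|a Aa] /=.
  by case: xgetP => [b _ [] //|noA]; case: An => a Aa fa; case: (noA a).
have fAa : (f @` A) (f a) by exists a.
exists (exist _ _ fAa) => //=; case: xgetP => [b _ [Ab fba]|/(_ a) []//].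
by apply: f_inj; rewrite ?inE.
Qed.

(** * Ordinals and cardinals *)

Lemma ZFmem_irrefl x : ~ x ∈ x.
Proof. by elim: (ZFmem_wf x) => y _ IH yy; apply: (IH y yy). Qed.

Lemma ZFmem_asym x y : x ∈ y -> ~ y ∈ x.
Proof.
elim: (ZFmem_wf x) y => {}x _ IH y xy yx; exact: (IH y yx x).
Qed.

Lemma ZFmem_minimal (P : set ZFset) x :
  P x -> exists2 m, P m & forall y, P y -> ~ y ∈ m.
Proof.
elim: (ZFmem_wf x) => {}x _ IH Px.
have [[y [Py yx]]|noy] := pselect (exists y, P y /\ y ∈ x); first exact: IH yx Py.
by exists x => // y Py yx; apply: noy; exists y.
Qed.

Lemma ordinal_mem a b : is_ordinal a -> b ∈ a -> is_ordinal b.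
Proof.
move=> [tra [irr tr tot least]] ba; have ba' := tra _ ba; split.
  by move=> c cb d dc; have ca := ba' c cb; apply: (tr d c b) => //; exact: tra dc.
split.
- by move=> x /ba'; apply: irr.
- by move=> x y z /ba' xa /ba' ya /ba' za; apply: tr.
- by move=> x y /ba' xa /ba'; apply: tot.
- by move=> B Bb; apply: least => x /Bb /ba'.
Qed.

Lemma ordinal_trans a b c : is_ordinal c -> a ∈ b -> b ∈ c -> a ∈ c.
Proof. by move=> [trc _] ab bc; apply: trc bc _ ab. Qed.

(** The membership-least element [m] of [b] outside [a] is [a] itself: minimality puts the elements
    of [m] in [a], and an element of [a] equal to or above [m] would put [m] in [a]. *)
Lemma transitive_sub_mem a b :
  transitive_set a -> is_ordinal b -> ord_le a b -> a <> b -> a ∈ b.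
Proof.
move=> tra [trb [_ trmem tot _]] ab neq.
have [x [xb xa]] : exists x, x ∈ b /\ ~ x ∈ a.
  apply: contrapT => nox; apply: neq; apply: elts_inj; apply/seteqP; split=> // x xb.
  by apply: contrapT => xa; apply: nox; exists x.
have [m [mb ma] min] := @ZFmem_minimal [set x | x ∈ b /\ ~ x ∈ a] x (conj xb xa).
suff -> : a = m by [].
apply: elts_inj; apply/seteqP; split=> y ya.
  have yb := ab y ya; have [//|ym|my] := tot y m yb mb.
    by case: ma; rewrite -ym.
  by case: ma; exact: tra ya _ my.
by apply: contrapT => ya'; apply: (min y _ ya); split=> //; exact: trb mb _ ya.
Qed.

Lemma ordinal_le_or_mem a b :
  is_ordinal a -> is_ordinal b -> ord_le a b \/ b ∈ a.
Proof.
(* If the intersection [c] differed from both [a] and [b], it would belong to both, hence to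
   itself. *)
move=> oa ob; have [c cE] := separation a (elts b).
have cP y : y ∈ c <-> y ∈ a /\ y ∈ b by rewrite -[y ∈ c]/(elts c y) cE.
have trc : transitive_set c.
  move=> y /cP[ya yb] z zy; apply/cP.
  by split; [exact: oa.1 ya _ zy|exact: ob.1 yb _ zy].
have ca : ord_le c a by move=> x /cP[].
have cb : ord_le c b by move=> x /cP[].
have [c_a|cna] := pselect (c = a); first by left; rewrite -c_a.
have [<-|cnb] := pselect (c = b); first by right; exact: transitive_sub_mem.
have /ZFmem_irrefl// : c ∈ c by apply/cP; split; exact: transitive_sub_mem.
Qed.

Lemma ordinal_trichotomy a b :
  is_ordinal a -> is_ordinal b -> [\/ a ∈ b, a = b | b ∈ a].
Proof.
move=> oa ob; have [ab|] := ordinal_le_or_mem oa ob; last by constructor 3.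
have [->|neq] := pselect (a = b); first by constructor 2.
by constructor 1; apply: transitive_sub_mem => //; case: oa.
Qed.

Lemma ord_le_mem_trans a b c : is_ordinal a -> is_ordinal c ->
  ord_le a b -> b ∈ c -> a ∈ c.
Proof.
move=> oa oc ab bc; have [ca|//] := ordinal_le_or_mem oc oa.
by have /ab/ZFmem_irrefl := ca _ bc.
Qed.

Lemma mem_ord_le a b : is_ordinal b -> a ∈ b -> ord_le a b.
Proof. by move=> [trb _]; apply: trb. Qed.

Lemma exists_least (P : set ZFset) a : P `<=` is_ordinal -> P a ->
  exists2 w, is_least P w & ord_le w a.
Proof.
move=> Pord Pa; have [m Pm min] := ZFmem_minimal Pa.
have le y : P y -> ord_le m y.
  by move=> Py; have [//|/(min _ Py)] := ordinal_le_or_mem (Pord _ Pm) (Pord _ Py).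
by exists m; [split|exact: le].
Qed.

Lemma exists_cardinal a : is_ordinal a ->
  exists c, [/\ is_cardinal c, ord_le c a & elts a #<= elts c].
Proof.
move=> oa; pose P := [set c | [/\ is_ordinal c, ord_le c a & elts a #<= elts c]].
have Pa : P a by split=> //; exact: card_lexx.
have [c [oc ca ac] min] := ZFmem_minimal Pa; exists c; split=> //; split=> // b bc.
apply/negP; rewrite card_eq_le => /andP[_ cb]; apply: (min b _ bc); split.
- exact: ordinal_mem bc.
- by apply: subset_trans ca; exact: mem_ord_le.
- exact: card_le_trans cb.
Qed.

Lemma cardinal_mem_lt c b : is_cardinal c -> b ∈ c -> ~ (elts c #<= elts b).
Proof.
move=> [oc init] bc cb; have /negP := init _ bc; apply; apply: Cantor_Bernstein => //.
exact/subset_card_le/mem_ord_le.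
Qed.

(** The ordinal [a] has at least aleph_n elements; unlike [is_omega], this does
    not presuppose that omega_n exists. *)
Fixpoint aleph_le (n : nat) (a : ZFset) : Prop :=
  match n with
  | 0 => infinite_set (elts a)
  | m.+1 => exists b, [/\ b ∈ a, aleph_le m b & ~ (elts a #<= elts b)]
  end.

Lemma aleph_le_infinite n a : is_ordinal a -> aleph_le n a -> infinite_set (elts a).
Proof.
elim: n a => [//|n IH] a oa /= [b [ba /IH inf _]].
by apply: sub_infinite_set (inf _); [exact: mem_ord_le|exact: ordinal_mem ba].
Qed.

Lemma aleph_le_subset n a b : ord_le a b -> aleph_le n a -> aleph_le n b.
Proof.
case: n => [|n] ab /=; first exact: sub_infinite_set.
move=> [c [ca nc acle]]; exists c; split=> //; first exact: ab.
by move=> bc; apply/acle/(card_le_trans (subset_card_le ab)).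
Qed.

Lemma aleph_le_card n a b : is_ordinal a -> is_ordinal b -> elts a #<= elts b ->
  aleph_le n a -> aleph_le n b.
Proof.
case: n => [|n] oa ob ab /=; first by move=> infa finb; apply/infa/(card_le_finite ab).
move=> [c [ca nc acle]]; exists c; split=> //; last first.
  by move=> bc; apply/acle/(card_le_trans ab).
have [bc|//] := ordinal_le_or_mem ob (ordinal_mem oa ca).
by case: acle; apply: card_le_trans ab (subset_card_le bc).
Qed.

Lemma is_omega_cardinal n w : is_omega n w -> is_cardinal w.
Proof. by case: n => [|n] [[]]. Qed.

Lemma is_omega_aleph_le n w : is_omega n w -> aleph_le n w.
Proof.
elim: n w => [|n IH] w /= [[cw]] // [l /IH nl lw] _.
by exists l; split=> //; exact: cardinal_mem_lt.
Qed.

(** From right to left, omega_m exists below the cardinality of the witness [b] by induction, so it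
    belongs to [k]; thus [k] itself is a candidate for omega_(m+1), and a least candidate exists. *)
Lemma aleph_leP n k : is_cardinal k ->
  (exists2 w, is_omega n w & ord_le w k) <-> aleph_le n k.
Proof.
move=> ck; split=> [[w /is_omega_aleph_le nw wk]|]; first exact: aleph_le_subset nw.
elim: n k ck => [|n IH] k ck /= nk.
  by apply: exists_least => // x [[]].
have [b [bk nb kb]] := nk.
have [c [cc cb bc]] := exists_cardinal (ordinal_mem ck.1 bk).
have [w0 omw0 w0c] := IH c cc (aleph_le_card (ordinal_mem ck.1 bk) cc.1 bc nb).
apply: exists_least => [x [[]]//|]; split=> //; exists w0 => //.
apply: (@ord_le_mem_trans _ b) => //; [exact: (is_omega_cardinal omw0).1|exact: ck.1|].
exact: subset_trans cb.
Qed.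

Lemma finite_ordinals_max (X : set ZFset) : finite_set X -> X !=set0 ->
  X `<=` is_ordinal -> exists2 m, X m & forall y, X y -> ord_le y m.
Proof.
move=> /finite_seqP[s ->]; elim: s => [|x s IH] /=; first by case.
move=> _ ord; have ox : is_ordinal x by apply: ord; rewrite /= mem_head.
have [s0|s0] := pselect ([set` s] !=set0); last first.
  exists x => [|y /=]; first by rewrite /= mem_head.
  by rewrite inE => /orP[/eqP -> //|ys]; case: s0; exists y.
have [|m ms mmax] := IH s0; first by
  move=> y ys; apply: ord; rewrite /= inE (ys : _ \in _) orbT.
have om : is_ordinal m by apply: ord; rewrite /= inE (ms : _ \in _) orbT.
have [xm|mx] := ordinal_le_or_mem ox om.
  exists m; first by rewrite /= inE (ms : _ \in _) orbT.
  by move=> y /=; rewrite inE => /orP[/eqP -> //|]; exact: mmax.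
exists x; first by rewrite /= mem_head.
move=> y /=; rewrite inE => /orP[/eqP -> //|/mmax ym].
by apply: subset_trans ym _; exact: mem_ord_le.
Qed.

(** * Free sets *)

(* Transfinite recursion: send [p] to any element of [A] not yet taken. *)
Lemma greedy_card_le T (U : pointedType) (lt : T -> T -> Prop) (S : set T) (A : set U) :
  well_founded lt ->
  (forall p q, S p -> S q -> [\/ lt p q, p = q | lt q p]) ->
  (forall p, S p -> ~ (A #<= [set q | S q /\ lt q p])) ->
  S #<= A.
Proof.
move=> wf tot small.
pose step p (rec : forall q, lt q p -> U) :=
  xget point [set a | A a /\ forall q (qp : lt q p), S q -> a <> rec q qp].
pose g := Fix wf (fun=> U) step.
have gE p : g p = step p (fun q _ => g q).
  apply: (Fix_eq wf (fun=> U) step) => x r s rs; congr step.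
  by apply: functional_extensionality_dep => y; apply/funext.
have gP p : S p -> A (g p) /\ forall q, lt q p -> S q -> g p <> g q.
  move=> Sp; rewrite [g p]gE /step; case: xgetP => [a _ //|none].
  case: (small p Sp); apply: (@card_le_sub_image _ _ _ _ g) => a Aa.
  apply: contrapT => na; apply: (none a); split=> // q qp Sq agq.
  by apply: na; exists q.
apply/card_le_injP; exists g => [p /gP[]//|p q /set_mem Sp /set_mem Sq gpq].
have [pq|//|qp] := tot p q Sp Sq.
- by case: ((gP q Sq).2 p pq Sp).
- by case: ((gP p Sp).2 q qp Sq).
Qed.

Lemma card_le_setX2 T (U : pointedType) (A : set T) (B : set U) :
  A #<= B -> A `*` A #<= B `*` B.
Proof.
move=> /card_le_injP[f fAB finj]; apply/card_le_injP.
exists (fun p => (f p.1, f p.2)) => [p [/= /fAB ? /fAB ?] //|].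
move=> [x y] [z t] /set_mem[/= Ax Ay] /set_mem[/= Az At] [].
by move=> /finj -> //; rewrite ?inE // => /finj ->; rewrite ?inE.
Qed.

Lemma infinite_two (T : pointedType) (A : set T) : infinite_set A ->
  exists x y, [/\ A x, A y & x <> y].
Proof.
move=> infA; have [x Ax] := infinite_setN0 infA.
apply: contrapT => no; apply: infA; apply: (sub_finite_set _ (finite_set1 x)).
move=> y Ay /=; apply: contrapT => yx; apply: no; exists y, x; split=> //.
Qed.

Lemma card_le_setU1 (T : pointedType) (A : set T) x : infinite_set A ->
  A `*` A #<= A -> A `|` [set x] #<= A.
Proof.
move=> infA; apply: card_le_trans.
have [Ax|nAx] := pselect (A x).
  rewrite setUidl; last by move=> _ ->.
  apply/card_le_injP; exists (fun y => (y, y)) => [y Ay|y z _ _ [] //].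
  by split.
have [a [b [Aa Ab ab]]] := infinite_two infA.
(* The second coordinate, [b] for [x] and [a] for all others, keeps the new point apart. *)
apply/card_le_injP; exists (fun y => if pselect (y = x) then (a, b) else (y, a)).
  by move=> y [Ay|->]; case: pselect.
move=> y z _ _; case: pselect => yx; case: pselect => zx /=.
- by rewrite yx zx.
- by case=> _ ba; case: ab.
- by case=> _ /esym ba; case: ab.
- by case.
Qed.

Definition ord_max (p : ZFset * ZFset) := if pselect (p.1 ∈ p.2) then p.2 else p.1.

Definition godel_lt (p q : ZFset * ZFset) :=
  slexprod _ _ ZFmem (slexprod _ _ ZFmem ZFmem) (ord_max p, p) (ord_max q, q).

Lemma godel_lt_wf : well_founded godel_lt.
Proof.
apply: (wf_inverse_image _ _ _ (fun p => (ord_max p, p))).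
by apply: wf_slexprod; [|apply: wf_slexprod]; exact: ZFmem_wf.
Qed.

Lemma slexprod_total T U (ltT : T -> T -> Prop) (ltU : U -> U -> Prop) p q :
  [\/ ltT p.1 q.1, p.1 = q.1 | ltT q.1 p.1] ->
  [\/ ltU p.2 q.2, p.2 = q.2 | ltU q.2 p.2] ->
  [\/ slexprod _ _ ltT ltU p q, p = q | slexprod _ _ ltT ltU q p].
Proof.
case: p q => [x y] [z t] /= [xz|->|zx].
- by move=> _; constructor 1; left.
- case=> [yt|->|ty]; first by constructor 1; right.
    by constructor 2.
  by constructor 3; right.
- by move=> _; constructor 3; left.
Qed.

(* Hessenberg: every proper initial segment of the Goedel ordering of [a * a]
   lies in [m+1 * m+1] for some [m] in [a]. *)
Lemma infinite_ordinal_square a : is_ordinal a -> infinite_set (elts a) ->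
  elts a `*` elts a #<= elts a.
Proof.
elim: (ZFmem_wf a) => {}a _ IH oa infa.
have memo x : x ∈ a -> is_ordinal x by exact: ordinal_mem.
(* If some [b] in [a] is as large as [a], the induction hypothesis for [b] carries over; otherwise
   [a] is an initial ordinal. *)
have [[b [ba ab]]|init] := pselect (exists b, b ∈ a /\ elts a #<= elts b).
  have infb : infinite_set (elts b) by move=> /(card_le_finite ab).
  apply: card_le_trans (card_le_setX2 ab) _.
  apply: card_le_trans (IH b ba (memo _ ba) infb) _.
  exact/subset_card_le/mem_ord_le.
have maxa p : (elts a `*` elts a) p -> ord_max p ∈ a.
  by move=> [p1 p2]; rewrite /ord_max; case: pselect.
apply: (@greedy_card_le _ _ godel_lt); first exact: godel_lt_wf.
  move=> p q Sp Sq; have tri x y (xa : x ∈ a) (ya : y ∈ a) :=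
    ordinal_trichotomy (memo x xa) (memo y ya).
  have [] : [\/ godel_lt p q, (ord_max p, p) = (ord_max q, q) | godel_lt q p].
  - apply: slexprod_total; first by apply: tri; exact: maxa.
    case: Sp Sq => p1 p2 [q1 q2].
    by apply: slexprod_total; apply: tri.
  - by constructor 1.
  - by case=> _ ->; constructor 2.
  - by constructor 3.
move=> p Sp aseg; set m := ord_max p; have ma : m ∈ a := maxa p Sp.
have {}aseg : elts a #<= (elts m `|` [set m]) `*` (elts m `|` [set m]).
  apply: card_le_trans aseg (subset_card_le _) => -[x y] [[/= xa ya] lt].
  have : ord_max (x, y) ∈ m \/ ord_max (x, y) = m.
    by move: lt; rewrite /godel_lt -/m => lt; inversion lt; [left|right].
  have maxP z : z = x \/ z = y -> z = ord_max (x, y) \/ z ∈ ord_max (x, y).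
    rewrite /ord_max /=; case: pselect => xy /= [->|->]; do ?[by left|by right].
    by have [//|->|] := ordinal_trichotomy (memo _ xa) (memo _ ya); [left|right].
  have sub z : z = x \/ z = y -> ord_max (x, y) ∈ m \/ ord_max (x, y) = m ->
      z ∈ m \/ z = m.
    move=> /maxP[->//|zmax] [mm|<-]; left=> //.
    exact: ordinal_trans (memo _ ma) zmax mm.
  by move=> xm; split; apply: sub => //; [left|right].
(* The square of [m + 1] is finite if [m] is, and otherwise no larger than [m] by induction; neither
   leaves room for [a]. *)
have [finm|infm] := pselect (finite_set (elts m)).
  by apply/infa/(card_le_finite aseg)/finite_setX; rewrite finite_setU; split.
apply: init; exists m; split=> //; have sqm := IH m ma (memo _ ma) infm.
apply: card_le_trans aseg _; apply: card_le_trans (sqm).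
by apply: card_le_setX2; exact: card_le_setU1 infm sqm.
Qed.

Lemma card_le_cover (T U : pointedType) (A : set T) (B : set U) :
  A #<= B -> exists h : U -> T, A `<=` h @` B.
Proof.
move=> /card_le_injP[f fAB finj].
exists (fun y => xget point [set x | A x /\ f x = y]) => x Ax.
exists (f x); first exact: fAB.
case: xgetP => [z _ [Az fzx]|/(_ x) []//].
by apply: finj; rewrite ?inE.
Qed.

(** As [b] covers its own square, a single element of [b] can encode an [n]-tuple [s] from [b]
    together with an index in an enumeration of [F s]. *)
Lemma infinite_ordinal_union b (F : seq ZFset -> set ZFset) n :
  is_ordinal b -> infinite_set (elts b) -> (forall s, countable (F s)) ->
  [set x | exists s, [/\ size s = n, {in s, forall y, y ∈ b} & F s x]] #<= elts b.
Proof.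
move=> ob infb ctblF.
have [p pP] := card_le_cover (infinite_ordinal_square ob infb).
have [q qP] := card_le_cover ((infiniteP _).1 infb).
have [e eP] := choice (fun s => card_le_cover (ctblF s)).
pose dec := fix dec n z := if n is m.+1 then (p z).1 :: dec m (p z).2 else [::].
have decP s : {in s, forall y, y ∈ b} -> exists2 z, z ∈ b & dec (size s) z = s.
  elim: s => [|y s IH] sb /=; first by have [z] := infinite_setN0 infb; exists z.
  have [|z zb zs] := IH; first by move=> x xs; apply: sb; rewrite inE xs orbT.
  have [|w wb pw] := pP (y, z); first by split=> //=; apply: sb; exact: mem_head.
  by exists w; rewrite // pw /= zs.
apply: (@card_le_sub_image _ _ _ _ (fun z => e (dec n (p z).1) (q (p z).2))).
move=> x [s [<- sb Fsx]]; have [k _ ekx] := eP s x Fsx.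
have [y yb ys] := decP s sb; have [z zb zk] := qP k I.
have [|w wb pw] := pP (y, z); first by split.
by exists w; rewrite // pw /= ys zk.
Qed.

(* Kuratowski's free set theorem.  In the inductive step the new point [x] is
   taken outside of all the values of [F] on the [n]-tuples of the smaller
   ordinal [b], and the other ones are free in [b] for [s |-> F (x :: s)]. *)
Lemma exists_free_set n a (F : seq ZFset -> set ZFset) :
  is_ordinal a -> aleph_le n a -> (forall s, countable (F s)) ->
  exists t : 'I_n -> ZFset, (forall i, t i ∈ a) /\
    forall i, ~ F [seq t j | j <- enum 'I_n & j != i] (t i).
Proof.
elim: n a F => [|n IH] a F oa na ctblF; first by exists (fun=> point); split; case.
have [b [ba nb ab]] := na; have ob := ordinal_mem oa ba.
have infb := aleph_le_infinite ob nb.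
have [x [xa xF]] : exists x, x ∈ a /\
    ~ exists s, [/\ size s = n, {in s, forall y, y ∈ b} & F s x].
  apply: contrapT => no; apply: ab.
  apply: card_le_trans (infinite_ordinal_union n ob infb ctblF).
  apply: subset_card_le => x xa; apply: contrapT => xF.
  by apply: no; exists x.
have [t [tb tfree]] := IH b (fun s => F (x :: s)) ob nb (fun s => ctblF (x :: s)).
pose u i := oapp t x (unlift ord0 i).
have u0 : u ord0 = x by rewrite /u unlift_none.
have uS j : u (lift ord0 j) = t j by rewrite /u liftK.
exists u; split=> i; case: (unliftP ord0 i) => [j|] ->.
- by rewrite uS; exact: mem_ord_le (tb j).
- by rewrite u0.
(* Index 0 comes first in the enumeration, so the points other than [t j] are listed as [x] followed
   by the rest of [t], which is the form that [tfree] speaks of. *)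
- rewrite uS enum_ordSl /= u0 filter_map -map_comp.
  rewrite (eq_map (g := t)); last by move=> k /=; exact: uS.
  rewrite (eq_filter (a2 := fun k => k != j)); first exact: tfree.
  by move=> k /=; rewrite (inj_eq lift_inj).
- rewrite enum_ordSl /= filter_map -map_comp u0 => Fx; apply: xF.
  eexists; split; last exact: Fx.
    rewrite size_map (eq_filter (a2 := predT)) ?filter_predT ?size_enum_ord //.
  by move=> y /mapP[k _ ->] /=; rewrite uS.
Qed.

(** * Directed families and clubs *)

Lemma directed_seq D (s : seq ZFset) : directed D ->
  {in s, forall y, exists2 A, A ∈ D & y ∈ A} ->
  exists2 A, A ∈ D & {in s, forall y, y ∈ A}.
Proof.
move=> [[A0 DA0] dir]; elim: s => [|x s IH] sD; first by exists A0.
have [|A DA sA] := IH; first by move=> y ys; apply: sD; rewrite inE ys orbT.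
have [B DB xB] := sD x (mem_head _ _).
have [C [DC AC BC]] := dir A B DA DB; exists C => // y.
by rewrite inE => /orP[/eqP ->|/sA/AC//]; exact: BC.
Qed.

Lemma directed_none_covers n kappa D : is_ordinal kappa -> aleph_le n kappa ->
  elts D `<=` ctbl_subsets kappa -> directed D -> union_of D kappa ->
  exists A : 'I_n -> ZFset, (forall i, A i ∈ D) /\ none_covers kappa A.
Proof.
move=> ok nk Dctbl dirD Dk.
have coverD (s : seq ZFset) : exists A,
    A ∈ D /\ ({in s, forall y, y ∈ kappa} -> {in s, forall y, y ∈ A}).
  (* Sequences that leave [kappa] get an arbitrary member of [D], so that [F] has countable values
     everywhere. *)
  have [sk|nsk] := pselect {in s, forall y, y ∈ kappa}; last first.
    by have [A DA] := dirD.1; exists A.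
  have [|A DA sA] := @directed_seq D s dirD; last by exists A.
  move=> y /sk yk; have : elts kappa y by [].
  by rewrite Dk => -[A DA yA]; exists A.
have [F FP] := choice coverD.
have ctblF s : countable (elts (F s)) by have [/Dctbl[]] := FP s.
have [t [tk tfree]] := exists_free_set ok nk ctblF.
pose others i := [seq t j | j <- enum 'I_n & j != i].
exists (fun i => F (others i)); split=> [i|i sub]; first by have [] := FP (others i).
apply: (tfree i); apply: sub; split=> [|j /eqP ji]; first exact: tk.
apply: (FP (others j)).2 => [y /mapP[k _ ->]//|].
by apply: map_f; rewrite mem_filter mem_enum eq_sym ji.
Qed.

Lemma club_directed kappa E : is_club kappa E -> directed E.
Proof.
move=> [Ectbl cof _]; split=> [|A B EA EB].
  have [z zE] := @separation_sub kappa set0 (@sub0set _ _).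
  have [|B EB _] := cof z; first by rewrite /ctbl_subsets /= zE; split.
  by exists B.
have [Ak Ac] := Ectbl A EA; have [Bk Bc] := Ectbl B EB.
have [z zE] := @separation_sub kappa (elts A `|` elts B)
  (fun x => ltac:(by move=> [/Ak|/Bk])).
have [|C EC zC] := cof z.
  rewrite /ctbl_subsets /= zE; split=> [x [/Ak|/Bk]//|].
  by rewrite -bigcup2E; apply: bigcup_countable => // -[|[|i]] _.
by exists C; split=> // x xz; apply: zC; rewrite zE; [left|right].
Qed.

Lemma club_union kappa E : is_club kappa E -> union_of E kappa.
Proof.
move=> [Ectbl cof _]; apply/seteqP; split=> [x xk|x [A /Ectbl[Ak _]]]; last exact: Ak.
have [z zE] := @separation_sub kappa [set x] (fun y => ltac:(by move=> ->)).
have [|B EB zB] := cof z.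
  rewrite /ctbl_subsets /= zE; split=> [_ ->//|].
  exact/finite_set_countable/finite_set1.
by exists B => //; apply: zB; rewrite zE.
Qed.

(** * Skolem hulls *)

Lemma H_mem theta x y : H theta x -> y ∈ x -> H theta y.
Proof.
move=> [le nle] yx; have sub : trcl y `<=` trcl x.
  by move=> z zy; apply: t_trans zy _; apply: t_step.
split; first exact: card_le_trans (subset_card_le sub) le.
by move=> ley; apply/nle/(card_le_trans ley)/subset_card_le.
Qed.

(** Values at or beyond this bound do not affect truth, so the parameters of a formula fit into a
    finite sequence, as [skolem] requires. *)
Fixpoint var_bound (p : formula) : nat :=
  match p with
  | fEq i j | fMem i j | fLt i j => maxn i.+1 j.+1
  | fNot p => var_bound p
  | fAnd p q => maxn (var_bound p) (var_bound q)
  | fEx _ p => var_bound p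
  end.

Lemma sat_agree (N : set ZFset) lt p u v :
  (forall k, k < var_bound p -> u k = v k)%N -> sat N lt u p -> sat N lt v p.
Proof.
suff {u v} agree : forall u v, (forall k, k < var_bound p -> u k = v k)%N ->
    sat N lt u p <-> sat N lt v p by move=> uv; case: (agree _ _ uv).
elim: p => [i j|i j|i j|p IHp|p IHp q IHq|i p IHp] u v uv /=.
1-3: by rewrite !uv ?leq_max ?leqnn ?orbT.
- by have := IHp u v uv; tauto.
- have := IHp u v; have := IHq u v => -[|qq qq'].
    by move=> k kq; apply: uv; rewrite leq_max kq orbT.
  case=> [k kp|pp pp']; first by apply: uv; rewrite leq_max kp.
  by split=> -[]; auto.
- have upd a k : (k < var_bound p)%N -> update u i a k = update v i a k.
    by move=> kp; rewrite /update; case: ifP => // _; exact: uv.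
  by split=> -[a Na sa]; exists a => //; apply/(IHp _ _ (upd a)).
Qed.

(** The embedding into generic trees makes formulas countable, on which the countability of hulls
    rests. *)
Fixpoint formula_code (p : formula) : GenTree.tree nat :=
  match p with
  | fEq i j => GenTree.Node 0 [:: GenTree.Leaf i; GenTree.Leaf j]
  | fMem i j => GenTree.Node 1 [:: GenTree.Leaf i; GenTree.Leaf j]
  | fLt i j => GenTree.Node 2 [:: GenTree.Leaf i; GenTree.Leaf j]
  | fNot p => GenTree.Node 3 [:: formula_code p]
  | fAnd p q => GenTree.Node 4 [:: formula_code p; formula_code q]
  | fEx i p => GenTree.Node 5 [:: GenTree.Leaf i; formula_code p]
  end.

Fixpoint formula_decode (t : GenTree.tree nat) : option formula :=
  match t with
  | GenTree.Node 0 [:: GenTree.Leaf i; GenTree.Leaf j] => Some (fEq i j)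
  | GenTree.Node 1 [:: GenTree.Leaf i; GenTree.Leaf j] => Some (fMem i j)
  | GenTree.Node 2 [:: GenTree.Leaf i; GenTree.Leaf j] => Some (fLt i j)
  | GenTree.Node 3 [:: p] => omap fNot (formula_decode p)
  | GenTree.Node 4 [:: p; q] =>
      if (formula_decode p, formula_decode q) is (Some p', Some q')
      then Some (fAnd p' q') else None
  | GenTree.Node 5 [:: GenTree.Leaf i; p] => omap (fEx i) (formula_decode p)
  | _ => None
  end.

Lemma formula_codeK : pcancel formula_code formula_decode.
Proof. by elim=> //= [p ->|p -> q ->|i p ->]. Qed.

HB.instance Definition _ := Countable.copy formula (pcan_type formula_codeK).

Section Hull.
Variables (N : set ZFset) (lt : ZFset -> ZFset -> Prop) (x : ZFset).

(** The default [x], both for a missing witness and for variables beyond [s], keeps all values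
    inside [N] once [x] is there. *)
Definition skolem (p : formula) (i : nat) (s : seq ZFset) : ZFset :=
  xget x [set a | N a /\ sat N lt (update (nth x s) i a) p].

Inductive hull (A : set ZFset) : ZFset -> Prop :=
| hull_point : hull A x
| hull_gen a of A a : hull A a
| hull_skolem p i s of (forall y, y \in s -> hull A y) : hull A (skolem p i s).

Lemma hull_sub A : N x -> A `<=` N -> hull A `<=` N.
Proof.
move=> Nx AN _ [//|a /AN//|p i s _].
by rewrite /skolem; case: xgetP => [a _ []//|].
Qed.

Lemma hull_min A B : A `<=` hull B -> hull A `<=` hull B.
Proof.
move=> AB a; elim=> [|b Ab|p i s _ IH]; first exact: hull_point.
  exact: AB.
exact: hull_skolem.
Qed.

Lemma hull_mono A B : A `<=` B -> hull A `<=` hull B.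
Proof. by move=> AB; apply: hull_min => a /AB; exact: hull_gen. Qed.

(** Every element of the hull is the value of a finite term: leaves name elements of [A], nodes
    carry the code of a formula and a variable, and the code of [None] stands for [x]. *)
Lemma countable_hull A : countable A -> countable (hull A).
Proof.
move=> /card_le_cover[e eP].
pose eval := fix eval (t : GenTree.tree nat) := match t with
  | GenTree.Leaf k => e k
  | GenTree.Node k ts =>
    if unpickle k is Some (Some (p, i)) then skolem p i (map eval ts) else x
  end.
have evalE (o : option (formula * nat)) ts : eval (GenTree.Node (pickle o) ts) =
    if o is Some (p, i) then skolem p i (map eval ts) else x.
  by rewrite /eval -/eval pickleK.
apply: (@sub_countable _ _ _ [set: GenTree.tree nat]); last exact: countableP.
apply: (@card_le_sub_image _ _ _ _ eval) => a.
elim=> [|b /eP[k _ <-]|p i s _ IH].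
- exists (GenTree.Node (pickle (@None (formula * nat))) [::]); rewrite // evalE.
- by exists (GenTree.Leaf k).
- have [ts <-] : exists ts, map eval ts = s.
    elim: s IH => [|y s IHs] IH; first by exists [::].
    have [t _ ty] := IH y (mem_head _ _).
    have [|ts tss] := IHs; first by move=> z zs; apply: IH; rewrite inE zs orbT.
    by exists (t :: ts); rewrite /= ty tss.
  by exists (GenTree.Node (pickle (Some (p, i))) ts); rewrite // evalE.
Qed.

(** This is the Tarski-Vaught criterion: an existential formula true in [N] is witnessed by its
    Skolem value, computed from the finite list [s] of relevant parameters. *)
Lemma hull_elementary A : N x -> A `<=` N -> elementary (hull A) N lt.
Proof.
move=> Nx AN; have hN := hull_sub Nx AN; split=> //.
  by exists x; exact: hull_point.
elim=> [i j|i j|i j|p IHp|p IHp q IHq|i p IHp] v vM //=.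
- by have := IHp v vM; tauto.
- by have := IHp v vM; have := IHq v vM; tauto.
have updM a : hull A a -> forall k, hull A (update v i a k).
  by move=> ha k; rewrite /update; case: ifP.
split=> [[a ha]|[a Na sa]].
  by move=> /(IHp _ (updM a ha)) sa; exists a => //; exact: hN.
pose s := map v (iota 0 (var_bound p)).
have agree b k : (k < var_bound p)%N -> update v i b k = update (nth x s) i b k.
  move=> kp; rewrite /update; case: ifP => // _.
  by rewrite (nth_map 0%N) ?size_iota // nth_iota.
have hb : hull A (skolem p i s) by apply: hull_skolem => y /mapP[k _ ->].
exists (skolem p i s) => //; apply/(IHp _ (updM _ hb)).
rewrite /skolem; case: xgetP => [b _ [_ sb]|/(_ a) []].
  by apply: sat_agree sb => k kp; rewrite agree.
by split=> //; exact: sat_agree (agree a) sa.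
Qed.

(** A Skolem value has finitely many arguments, and in a chain these already lie in the hull of one
    member. This gives closure of the club under unions of chains. *)
Lemma hull_chain_union (C : set (set ZFset)) : C !=set0 ->
  (forall A B, C A -> C B -> A `<=` B \/ B `<=` A) ->
  hull (\bigcup_(A in C) A) `<=` \bigcup_(A in C) hull A.
Proof.
move=> [A0 CA0] chain a; elim=> [|b [A CA Ab]|p i s _ IH].
- by exists A0 => //; exact: hull_point.
- by exists A => //; exact: hull_gen.
- suff [A CA sA] : exists2 A, C A & forall y, y \in s -> hull A y.
    by exists A => //; exact: hull_skolem.
  elim: s IH => [|y s IHs] IH; first by exists A0.
  have [|A CA sA] := IHs; first by move=> z zs; apply: IH; rewrite inE zs orbT.
  have [B CB yB] := IH y (mem_head _ _).
  have [AB|BA] := chain _ _ CA CB.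
    by exists B => // z; rewrite inE => /orP[/eqP -> //|/sA]; exact: hull_mono.
  exists A => // z; rewrite inE => /orP[/eqP ->|/sA //]; exact: hull_mono yB.
Qed.

End Hull.

Lemma exists_elementary_club kappa theta lt x :
  H theta kappa -> H theta x -> exists E, is_club kappa E /\
    forall B, B ∈ E -> exists M : ZFset, [/\ countable (elts M),
      elementary (elts M) (H theta) lt, x ∈ M & elts kappa `&` elts M = elts B].
Proof.
move=> Hk Hx; pose N := H theta.
have kN : elts kappa `<=` N by move=> y; exact: H_mem.
pose P := [set A | ctbl_subsets kappa A /\
  elts kappa `&` hull N lt x (elts A) `<=` elts A].
have [E EE] : exists E, elts E = P by apply: (@family_of_subsets kappa) => A [[]].
exists E; split; last first.
  move=> B EB; have [[Bk Bc] Bh] : P B by rewrite -EE.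
  have [M ME] := countable_ZFset (countable_hull N lt x Bc).
  exists M; rewrite -[x ∈ M]/(elts M x) ME; split.
  - exact: countable_hull.
  - by apply: hull_elementary => //; exact: subset_trans kN.
  - exact: hull_point.
  - apply/seteqP; split=> // y By; split; [exact: Bk|exact: hull_gen].
split.
- by rewrite EE => A [].
- move=> A [Ak Ac].
  (* The trace [B] of the hull of [A] is closed, since the hull of [B] stays inside the hull of
     [A]. *)
  have [B BE] := separation kappa (hull N lt x (elts A)).
  exists B; last by rewrite BE => y Ay; split; [exact: Ak|exact: hull_gen].
  rewrite -[B ∈ E]/(elts E B) EE /P /ctbl_subsets /= BE; split.
    split=> [y []//|]; apply: sub_countable (countable_hull N lt x Ac).
    by apply: subset_card_le => y [].
  move=> y [yk hy]; split=> //; apply: hull_min hy.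
  by move=> z [].
- move=> C U CE Cc C0 Cchain CU.
  have CP A : A ∈ C -> P A by move=> /CE; rewrite EE.
  rewrite -[U ∈ E]/(elts E U) EE; split; first split.
  + by rewrite CU => y [A /CP[[Ak _] _]]; exact: Ak.
  + by rewrite CU; apply: bigcup_countable => // A /CP[[]].
  move=> y [yk]; rewrite CU.
  have -> : \bigcup_(A in elts C) elts A = \bigcup_(A in elts @` elts C) A.
    by rewrite bigcup_image.
  move=> /hull_chain_union[].
  + by have [A CA] := C0; exists (elts A), A.
  + by move=> _ _ [A CA <-] [B CB <-]; exact: Cchain.
  move=> _ [A CA <-] hy; exists (elts A); first by exists A.
  by have [_] := CP A CA; apply.
Qed.

(** Serves to pass from members of a club to the models whose traces on [kappa] they are. *)
Lemma none_covers_trace n kappa (A B : 'I_n -> ZFset) :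
  (forall i, elts kappa `&` elts (A i) = elts kappa `&` elts (B i)) ->
  none_covers kappa A -> none_covers kappa B.
Proof.
move=> AB nA i sub; apply: (nA i) => x [xk xA].
suff : (elts kappa `&` elts (A i)) x by case.
rewrite AB; split=> //; apply: sub; split=> // j ji.
have : (elts kappa `&` elts (B j)) x by rewrite -AB; split=> //; exact: xA.
by case.
Qed.

(** * Definable elements of elementary substructures *)

(* Some [r] in [M] satisfies [p]; if [r <> a], then [a] is the only solution of
   [p] other than [r]. *)
Lemma elementary_definable2 (M N : set ZFset) lt p i v a b :
  elementary M N lt -> (forall k, M (v k)) ->
  (forall y, N y -> sat N lt (update v i y) p -> y = a \/ y = b) ->
  N a -> sat N lt (update v i a) p -> M a.
Proof.
move=> [_ MN elem] vM only Na pa.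
have updM k u r : M r -> (forall l, M (u l)) -> forall l, M (update u k r l).
  by move=> Mr uM l; rewrite /update; case: ifP.
have [r Mr pr] : sat M lt v (fEx i p) by apply/(elem _ _ vM); exists a.
have := only r (MN r Mr) ((elem _ _ (updM i v r Mr vM)).1 pr).
have [<-//|ra rb] := pselect (r = a); case: rb => // rb; subst r.
(* The variable [k] is fresh for [p] and differs from [i]. It holds the parameter [b], now known to
   lie in [M], so that [a] becomes the only solution of [p] distinct from it. *)
pose k := maxn i.+1 (var_bound p).
have ki : (k == i) = false by apply/gtn_eqF; rewrite leq_max leqnn.
have wM := updM k v b Mr vM; set w := update v k b in wM.
have agree c l : (l < var_bound p)%N -> update v i c l = update w i c l.
  move=> lp; rewrite /w /update; case: ifP => // _; rewrite ltn_eqF //.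
  by rewrite leq_max lp orbT.
have wk c : update w i c k = b by rewrite /w /update ki eqxx.
have wi c : update w i c i = c by rewrite /update eqxx.
have [s Ms] : sat M lt w (fEx i (fAnd p (fNot (fEq i k)))).
  apply/(elem _ _ wM); exists a => //=; split; first exact: sat_agree (agree a) pa.
  by rewrite wk wi => ab; apply: ra.
move=> /(elem (fAnd p (fNot (fEq i k))) _ (updM i w s Ms wM)).1 /= [ps]; rewrite wk wi => sb.
have [<-//|//] := only s (MN s Ms) (sat_agree (fun l lp => esym (agree s l lp)) ps).
Qed.

(** * Descent through injections of ordinals into their cardinals *)

Lemma exists_collapse : exists (c : ZFset -> ZFset) (f : ZFset -> ZFset -> ZFset),
  forall b, is_ordinal b -> [/\ is_cardinal (c b), ord_le (c b) b,
    forall d, d ∈ b -> f b d ∈ c b & set_inj (elts b) (f b)].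
Proof.
have collapse b : exists cf : ZFset * (ZFset -> ZFset), is_ordinal b ->
    [/\ is_cardinal cf.1, ord_le cf.1 b,
      forall d, d ∈ b -> cf.2 d ∈ cf.1 & set_inj (elts b) cf.2].
  have [ob|nob] := pselect (is_ordinal b); last by exists (b, id).
  have [c [cc cb /card_le_injP[f fc finj]]] := exists_cardinal ob.
  by exists (c, f).
have [cf cfP] := choice collapse.
by exists (fun b => (cf b).1), (fun b => (cf b).2) => b /cfP.
Qed.

(* If [t i] lies in all [M j] but [M i], and [t k] is the largest of the [t i],
   then so do the [f (t k) (t i)], [i <> k], for one structure and one cardinal
   less. *)
Lemma no_free_family (T : finType) (M : T -> set ZFset) kappa c f m
    (I : {set T}) k (t : T -> ZFset) :
  (forall b, is_ordinal b -> [/\ is_cardinal (c b), ord_le (c b) b,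
    forall d, d ∈ b -> f b d ∈ c b & set_inj (elts b) (f b)]) ->
  (forall i b, b ∈ kappa -> finite_set (elts b) -> M i b) ->
  (forall i b d y, b ∈ kappa -> d ∈ b -> y ∈ b -> M i b -> M i d ->
    f b d = y \/ f b y = d -> M i y) ->
  #|I| = m.+1 -> is_cardinal k -> ord_le k kappa -> ~ aleph_le m.+1 k ->
  (forall i, i \in I -> [/\ t i ∈ k, ~ M i (t i) &
    forall j, j \in I -> j != i -> M j (t i)]) -> False.
Proof.
move=> cf Mfin Mf; elim: m I k t => [|m IH] I k t cardI ck kk nk tP.
  have /eqP/cards1P[i Ii] := cardI.
  have [tik nM _] : [/\ t i ∈ k, ~ M i (t i) &
    forall j, j \in I -> j != i -> M j (t i)] by apply: tP; rewrite Ii inE.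
  (* Here [k] is not above aleph_0, so its element [t i] is finite and cannot be left out of
     [M i]. *)
  apply: nM; apply: Mfin; first exact: kk.
  apply: contrapT => inf; apply: nk; exists (t i); split=> //.
  exact: cardinal_mem_lt.
have ot i : i \in I -> is_ordinal (t i).
  by move=> /tP[tik _ _]; exact: ordinal_mem ck.1 tik.
have [_ [k0 /= k0I <-] k0max] : exists2 b, (t @` [set` I]) b &
    forall y, (t @` [set` I]) y -> ord_le y b.
  apply: finite_ordinals_max; first exact/finite_image/finite_finset.
    have [i iI] : exists i, i \in I by apply/card_gt0P; rewrite cardI.
    by exists (t i), i.
  by move=> _ [i /= iI <-]; exact: ot.
have [tk0 nMk0 Mk0] := tP k0 k0I.
have ltk0 i : i \in I -> i != k0 -> t i ∈ t k0.
  move=> iI ik0; apply: transitive_sub_mem; [exact: (ot i iI).1|exact: ot| |].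
    by apply: k0max; exists i.
  (* The maximum is strict, because [M k0] contains [t i] but not [t k0]. *)
  move=> E; have [_ _ /(_ k0 k0I)] := tP i iI.
  by rewrite E eq_sym => /(_ ik0).
have [cc cb fc finj] := cf _ (ot k0 k0I).
apply: (IH (I :\ k0) (c (t k0)) (fun i => f (t k0) (t i))) => //.
- by move: cardI; rewrite (cardsD1 k0) k0I => -[].
- by apply: subset_trans cb _; apply: subset_trans kk; exact: mem_ord_le ck.1 tk0.
- move=> nc; apply: nk; exists (t k0); split=> //; last exact: cardinal_mem_lt.
  exact: aleph_le_subset cb nc.
move=> i; rewrite in_setD1 => /andP[ik0 iI]; have [tik nM MI] := tP i iI.
have tk0k : t k0 ∈ kappa by exact: kk.
have tilt := ltk0 i iI ik0.
split; first exact: fc.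
  (* Since [t k0] is in [M i], the image of [t i] cannot be: inverting the injection would bring
     [t i] back. *)
  move=> Mfi; apply: nM; apply: (Mf i (t k0) (f (t k0) (t i))) => //; last by right.
  - by apply: cb; exact: fc.
  - exact: Mk0.
move=> j; rewrite in_setD1 => /andP[jk0 jI] ji.
apply: (Mf j (t k0) (t i)) => //; last by left.
- by apply: cb; exact: fc.
- exact: Mk0.
- exact: MI.
Qed.

(* [f] as a family of countable subsets of [kappa], which [large_enough] puts
   into H(theta).  Although the triples are unordered, their maximum [b] and [d]
   leave only two values for the third element, [f b d] and the preimage of [d]
   under [f b].  The singletons make [kappa] the union of the family. *)
Definition collapse_triples kappa (f : ZFset -> ZFset -> ZFset) : set ZFset :=
  [set e | (exists b d, [/\ b ∈ kappa, d ∈ b &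
             elts e = [set z | [\/ z = d, z = f b d | z = b]]]) \/
           exists2 a, a ∈ kappa & elts e = [set a]].

Section Definability.
Variables (theta kappa D : ZFset) (lt : ZFset -> ZFset -> Prop) (M : set ZFset).
Variables (c : ZFset -> ZFset) (f : ZFset -> ZFset -> ZFset).
Hypothesis cf : forall b, is_ordinal b -> [/\ is_cardinal (c b), ord_le (c b) b,
  forall d, d ∈ b -> f b d ∈ c b & set_inj (elts b) (f b)].
Hypothesis kappa_ord : is_ordinal kappa.
Hypothesis DE : elts D = collapse_triples kappa f.
Hypothesis HD : H theta D.
Hypothesis elemM : elementary M (H theta) lt.
Hypothesis MD : M D.

Lemma collapse_mem b d : b ∈ kappa -> d ∈ b -> f b d ∈ b.
Proof.
by move=> /(ordinal_mem kappa_ord)/cf[_ cb fc _] db; apply: cb; exact: fc.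
Qed.

Lemma triples_sub e : collapse_triples kappa f e -> elts e `<=` elts kappa.
Proof.
move=> [[b [d [bk db ->]]]|[a ak ->]]; last by move=> _ ->.
have bk' := mem_ord_le kappa_ord bk; have fb := collapse_mem bk db.
by move=> z [->|->|->] //; exact: bk'.
Qed.

Lemma mem_D e : e ∈ D <-> collapse_triples kappa f e.
Proof. by rewrite -[e ∈ D]/(elts D e) DE. Qed.

(** Allows formulas to speak of [kappa] with [D] as the only parameter. *)
Lemma mem_kappaP y : y ∈ kappa <-> exists2 e, H theta e & e ∈ D /\ y ∈ e.
Proof.
split=> [yk|[e _ [/mem_D/triples_sub]]]; last exact.
have [e eE] := @separation_sub kappa [set y] (fun z => ltac:(by move=> ->)).
have eD : e ∈ D by apply/mem_D; right; exists y.
exists e; first exact: H_mem HD eD.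
by split=> //; rewrite -[y ∈ e]/(elts e y) eE.
Qed.

Lemma H_kappa y : y ∈ kappa -> H theta y.
Proof. by move=> /mem_kappaP[e He [_ ye]]; exact: H_mem He ye. Qed.

Lemma finite_ordinal_mem_elementary b : b ∈ kappa -> finite_set (elts b) -> M b.
Proof.
(* Variable 0 stands for [D] and variable 3 for the element being defined. *)
pose in_kappa := fEx 4 (fAnd (fMem 4 0) (fMem 3 4)).
elim: (ZFmem_wf b) => {}b _ IH bk finb.
have Hb := H_kappa bk; have ob := ordinal_mem kappa_ord bk.
have [b0|/set0P b0] := eqVneq (elts b) set0.
  apply: (@elementary_definable2 M (H theta) lt
    (fAnd in_kappa (fNot (fEx 5 (fMem 5 3)))) 3 (fun=> D) b b) => //=.
    move=> y Hy [_ ne]; left; apply: elts_inj; rewrite b0.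
    rewrite -subset0 => z zy; apply: ne; exists z => //; exact: H_mem Hy zy.
  split; first by apply/mem_kappaP.
  move=> [z _]; rewrite /update /= => zb.
  have : elts b z by []. 
  by rewrite b0.
have obs : elts b `<=` is_ordinal by move=> y; exact: ordinal_mem.
(* A nonzero finite [b] is the successor of its maximum [a]: the element of [kappa] above [a] with
   nothing in between. *)
have [a ab amax] := finite_ordinals_max finb b0 obs.
have ak : a ∈ kappa := ordinal_trans kappa_ord ab bk.
have Ma : M a.
  by apply: IH => //; apply: sub_finite_set finb; exact: mem_ord_le.
pose v k := nth D [:: D; a] k.
apply: (@elementary_definable2 M (H theta) lt (fAnd in_kappa (fAnd (fMem 1 3)
  (fNot (fEx 5 (fAnd (fMem 5 3) (fMem 1 5)))))) 3 v b b) => //=.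
- by move=> [|[|k]] //; rewrite /v /= nth_nil.
- move=> y Hy [/mem_kappaP yk]; rewrite /update /v /= => -[ay ne]; left.
  have oy := ordinal_mem kappa_ord yk.
  have [yb|//|by_] := ordinal_trichotomy oy ob.
    by have /ZFmem_irrefl := amax _ yb _ ay.
  by case: ne; exists b => //; exact: ab.
- split; first by apply/mem_kappaP.
  split=> // -[z _]; rewrite /update /v /= => -[zb az].
  by have /ZFmem_irrefl := amax _ zb _ az.
Qed.

Lemma collapse_mem_elementary b d y : b ∈ kappa -> d ∈ b -> y ∈ b ->
  M b -> M d -> f b d = y \/ f b y = d -> M y.
Proof.
move=> bk db yb Mb Md fdy; have [<-//|/eqP dy] := eqVneq d y.
have ob := ordinal_mem kappa_ord bk; have [_ _ _ finj] := cf ob.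
pose v k := nth D [:: D; b; d] k.
(* The formula says that variable 3 is an element of [b], distinct from [d], that shares a member of
   [D] with [b] and [d]. *)
pose p := fAnd (fMem 3 1) (fAnd (fNot (fEq 3 2)) (fEx 4 (fAnd (fMem 4 0)
  (fAnd (fMem 2 4) (fAnd (fMem 3 4) (fMem 1 4)))))).
have triple e z : e ∈ D -> d ∈ e -> z ∈ e -> b ∈ e -> z ∈ b -> z <> d ->
    f b d = z \/ f b z = d.
  move=> /mem_D[[b0 [d0 [bk0 db0 eE]]]|[a ak eE]]; last first.
    rewrite -![_ ∈ e]/(elts e _) eE /= => da _ ba.
    by have := db; rewrite da ba => /ZFmem_irrefl.
  rewrite -![_ ∈ e]/(elts e _) eE /= => de ze be zb zd.
  have fb0 := collapse_mem bk0 db0.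
  have nb0 w : w ∈ b -> b ∈ b0 -> w <> b0.
    by move=> wb bb0 wb0; apply: (ZFmem_asym bb0); rewrite -wb0.
  have nirr w : w ∈ b -> w <> b by move=> wb E; move: wb; rewrite E => /ZFmem_irrefl.
  (* Were [b] one of the two smaller entries of the triple, [d] and [z], both below [b], would have
     to equal the single remaining entry. *)
  have bE : b = b0.
    case: be => [bd|bf|//].
      have bb0 : b ∈ b0 by rewrite bd.
      case: de => [|dE|/(nb0 _ db bb0)//]; first by rewrite -bd => /(nirr _ db).
      case: ze => [|zE|/(nb0 _ zb bb0)//]; first by rewrite -bd => /(nirr _ zb).
      by case: zd; rewrite zE.
    have bb0 : b ∈ b0 by rewrite bf.
    case: de => [dE||/(nb0 _ db bb0)//]; last by rewrite -bf => /(nirr _ db).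
    case: ze => [zE||/(nb0 _ zb bb0)//]; last by rewrite -bf => /(nirr _ zb).
    by case: zd; rewrite zE.
  subst b0.
  case: de => [dE|dE|/(nirr _ db)//]; case: ze => [zE|zE|/(nirr _ zb)//].
  - by case: zd; rewrite zE.
  - by left; rewrite dE.
  - by right; rewrite zE.
  - by case: zd; rewrite zE.
have sat_y : sat (H theta) lt (update v 3 y) p.
  rewrite /= /update /v /=; split=> //; split; first by move=> /esym.
  have bdy : [set z | [\/ z = d, z = y | z = b]] `<=` elts kappa.
    by move=> z [->|->|->] //; [exact: ordinal_trans db bk|exact: ordinal_trans yb bk].
  have [e eE] := separation_sub bdy.
  have eD : e ∈ D.
    apply/mem_D; left; case: fdy => fE.
      by exists b, d; split=> //; rewrite eE fE.
    exists b, y; split=> //; rewrite eE fE; apply/seteqP.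
    by split=> z [->|->|->]; [constructor 2|constructor 1|constructor 3|
      constructor 2|constructor 1|constructor 3].
  exists e; first exact: H_mem HD eD.
  by rewrite -![_ ∈ e]/(elts e _) eE /=; split=> //;
    split; [constructor 1|split; [constructor 2|constructor 3]].
have Hy : H theta y by apply: H_kappa; exact: ordinal_trans yb bk.
have vM k : M (v k) by case: k => [|[|[|k]]] //; rewrite /v /= nth_nil.
have sat_only z : sat (H theta) lt (update v 3 z) p -> f b d = z \/ z ∈ b /\ f b z = d.
  rewrite /= /update /v /= => -[zb [zd [e _ [eD [de [ze be]]]]]].
  by have [|] := triple e z eD de ze be zb zd; auto.
(* The candidates are [f b d] and the preimage [w] of [d], if there is one; [y] is one of them, and
   the other one is passed as the second solution. *)
have [[w [wb fw]]|now] := pselect (exists w, w ∈ b /\ f b w = d).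
  apply: (elementary_definable2 (a := y) (b := if pselect (f b d = y) then w else f b d)
    elemM vM _ Hy sat_y).
  move=> z _ /sat_only; case: pselect => /= fy.
    move=> [<-|[zb fz]]; first by left.
    by right; apply: finj; rewrite ?inE // fw.
  case: fdy => // fdy [<-|[zb fz]]; first by right.
  by left; apply: finj; rewrite ?inE // fz.
apply: (elementary_definable2 (a := y) (b := y) elemM vM _ Hy sat_y).
move=> z _ /sat_only [<-|[zb fz]]; last by case: now; exists z.
by case: fdy => [|fdy]; [left|case: now; exists y].
Qed.

End Definability.

(** * From elementary substructures back to cardinality, and the cycle of implications *)

Lemma none_covers_aleph_le m kappa theta lt : is_cardinal kappa ->
  (forall D, elts D `<=` ctbl_subsets kappa -> H theta D) ->
  (forall x, H theta x -> exists M : 'I_m.+1 -> ZFset,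
    (forall i, elementary (elts (M i)) (H theta) lt /\ x ∈ M i) /\
    none_covers kappa M) ->
  aleph_le m.+1 kappa.
Proof.
move=> ck Hctbl models; apply: contrapT => nk.
have [c [f cf]] := exists_collapse.
have [D DE] := family_of_subsets (triples_sub cf ck.1).
have HD : H theta D.
  apply: Hctbl => e; rewrite DE => eT; split; first exact: (triples_sub cf ck.1 eT).
  apply: finite_set_countable; case: eT => [[b [d [_ _ ->]]]|[a _ ->]]; last first.
    exact: finite_set1.
  apply: (sub_finite_set _ (finite_set3 d (f b d) b)).
  by move=> z [->|->|->]; [left; left|left; right|right].
have [M [elemM coverM]] := models D HD.
have left_out i : exists y, [/\ y ∈ kappa, ~ y ∈ M i & forall j, j != i -> y ∈ M j].
  apply: contrapT => no; apply: (coverM i) => y [yk yM].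
  apply: contrapT => nyM; apply: no; exists y; split=> // j /eqP ji.
  exact: yM.
have [t tP] := choice left_out.
apply: (@no_free_family _ (fun i => elts (M i)) kappa c f m [set: 'I_m.+1] kappa t) => //.
- move=> i b bk finb; have [el DM] := elemM i.
  exact: (finite_ordinal_mem_elementary cf ck.1 DE HD el DM bk finb).
- move=> i b d y bk db yb Mb Md fdy; have [el DM] := elemM i.
  exact: (collapse_mem_elementary cf ck.1 DE HD el DM bk db yb Mb Md fdy).
- by rewrite cardsT card_ord.
- by move=> i _; have [tk tM tMj] := tP i; split=> // j _; exact: tMj.
Qed.

Theorem theorem4p8 (n : nat) (kappa theta : ZFset)
    (lt : ZFset -> ZFset -> Prop)
    (n_ge1 : (1 <= n)%N)
    (kappa_card : is_cardinal kappa)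
    (theta_regular : is_regular theta)
    (theta_uncountable : ~ countable (elts theta))
    (theta_large : large_enough n kappa theta)
    (lt_wo : well_orders (H theta) lt) :
  [<->
    (* 1 *)
    exists2 w, is_omega n w & ord_le w kappa;
    (* 2 *)
    forall D : ZFset,
      elts D `<=` ctbl_subsets kappa -> directed D -> union_of D kappa ->
      exists A : 'I_n -> ZFset, (forall i, A i ∈ D) /\ none_covers kappa A;
    (* 3 *)
    forall E : ZFset, is_club kappa E ->
      exists B : 'I_n -> ZFset, (forall i, B i ∈ E) /\ none_covers kappa B;
    (* 4 *)
    forall x : ZFset, H theta x ->
      exists M : 'I_n -> ZFset,
        (forall i, [/\ countable (elts (M i)),
                       elementary (elts (M i)) (H theta) lt & x ∈ M i]) /\
        none_covers kappa M;
    (* 5 *)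
    forall x : ZFset, H theta x ->
      exists M : 'I_n -> ZFset,
        (forall i, elementary (elts (M i)) (H theta) lt /\ x ∈ M i) /\
        none_covers kappa M
  ].
Proof.
have [Hkappa _ Hctbl] := theta_large; tfae.
- move=> /(aleph_leP _ kappa_card) nk D; exact: directed_none_covers kappa_card.1 nk.
- move=> dir E clubE; apply: dir; first by case: clubE.
    exact: club_directed clubE.
  exact: club_union clubE.
- move=> club x Hx; have [E [clubE EP]] := exists_elementary_club lt Hkappa Hx.
  have [B [EB nB]] := club E clubE.
  have [M MP] := choice (fun i => EP (B i) (EB i)).
  exists M; split=> [i|]; first by have [] := MP i.
  apply: none_covers_trace nB => i; have [_ _ _ ->] := MP i.
  by apply: setIidr; case: clubE => /(_ _ (EB i))[].
- move=> models x /models[M [MP nM]]; exists M; split=> // i.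
  by have [] := MP i.
- case: n n_ge1 {theta_large} => // m _ models.
  exact/(aleph_leP _ kappa_card)/(none_covers_aleph_le kappa_card Hctbl models).
Qed.
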